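(* Let $0<p<1/2$ and let $\Phi\colon\mathbb N_+\to[1,\infty)$ be a non-decreasing function with $\Phi(n)\to\infty$ and $$\limsup_{k\to\infty}\frac{2^{k(2-2p)}}{\Phi(2^k)}=\infty.$$ Then there exists a martingale $F\in H_p(G)$ such that $$\sum_{m=1}^{\infty}\frac{\Vert \sigma_m^\kappa F\Vert_{L_{p,\infty}}^p}{\Phi(m)}=\infty.$$
   Context: $G$ is the Walsh (dyadic) group: the set of sequences $x=(x_0,x_1,\dots)$ with $x_k\in\{0,1\}$, with coordinatewise addition mod 2 and normalized Haar measure $\mu$. $\mathcal F_n$ is the $\sigma$-algebra generated by the dyadic intervals $I_n(x)=\{y\in G: y_i=x_i \text{ for } i<n\}$. The Rademacher functions are $r_k(x)=(-1)^{x_k}$. For $n\in\mathbb N$ write $n=\sum_i n_i2^i$ with $n_i\in\{0,1\}$ and, for $n\ge1$, $|n|=\max\{j:n_j\neq0\}$. The Walsh–Kaczmarz functions are $\kappa_0=1$ and, for $n\geq1$, $\kappa_n(x)=r_{|n|}(x)(-1)^{\sum_{k=0}^{|n|-1}n_kx_{|n|-1-k}}$. A martingale $f=(f^{(n)})_{n}$ with respect to $(\mathcal F_n)$ belongs to the Hardy space $H_p(G)$ if $\Vert f\Vert_{H_p}:=\Vert \sup_n|f^{(n)}|\Vert_{L_p(G)}<\infty$. The Walsh–Kaczmarz–Fourier coefficients of a martingale are $\widehat f^\kappa(i)=\lim_{k\to\infty}\int_G f^{(k)}\kappa_i\,d\mu$; partial sums are $S_j^\kappa f=\sum_{k=0}^{j-1}\widehat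 f^\kappa(k)\kappa_k$, and Fejér means are $\sigma_n^\kappa f=\frac1n\sum_{j=1}^nS_j^\kappa f$. The weak $L_p$ quasi-norm is given by $\Vert g\Vert_{L_{p,\infty}}^p=\sup_{\lambda>0}\lambda^p\mu(\{x\in G:|g(x)|>\lambda\})$. *)

(* Defs.v *)
From HB Require Import structures.
From mathcomp Require Import all_boot all_order all_algebra.
From mathcomp Require Import all_classical all_reals all_analysis.
Set Implicit Arguments. Unset Strict Implicit. Unset Printing Implicit Defensive.
Import Order.TTheory GRing.Theory Num.Theory.
Import numFieldNormedType.Exports.
Local Open Scope classical_set_scope.
Local Open Scope ring_scope.

Definition G := nat -> bool.

Section Walsh.
Variable R : realType.

Definition digits (t : R) : G := fun k => odd (Num.truncn (t * 2 ^+ k.+1)).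

Definition I01 : set R := [set t | 0 <= t < 1].

(** Normalized Haar measure mu on G, realized as the push-forward of Lebesgue
    measure on [0,1) under the dyadic-digit map (the product measure). *)
Definition mu (A : set G) : \bar R :=
  (lebesgue_measure : set R -> \bar R) (I01 `&` (digits @^-1` A)).

Definition Gint (A : set G) (g : G -> \bar R) : \bar R :=
  (\int[lebesgue_measure]_(t in I01 `&` (digits @^-1` A)) g (digits t))%E.

Definition Idy (n : nat) (x : G) : set G := [set y | forall i, (i < n)%N -> y i = x i].

Definition Fn_meas (n : nat) (g : G -> R) : Prop :=
  forall x y, (forall i, (i < n)%N -> x i = y i) -> g x = g y.

(** Martingales with respect to (F_n): f^(n) is F_n-measurable and
    E(f^(n+1) | F_n) = f^(n), i.e. integrals over the atoms of F_n agree. *)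
Definition martingale (f : nat -> G -> R) : Prop :=
  (forall n, Fn_meas n (f n)) /\
  (forall n x, Gint (Idy n x) (fun y => (f n.+1 y)%:E) = Gint (Idy n x) (fun y => (f n y)%:E)).

Definition maxf (f : nat -> G -> R) (x : G) : \bar R :=
  ereal_sup (range (fun n => (`|f n x|)%:E)).

Definition in_Hp (p : R) (f : nat -> G -> R) : Prop :=
  martingale f /\ (Gint setT (fun x => poweR (maxf f x) p) < +oo)%E.

Definition rad (k : nat) (x : G) : R := (-1) ^+ x k.

Definition nabs (n : nat) : nat := trunc_log 2 n.
Definition nbit (n k : nat) : bool := odd (n %/ 2 ^ k).

Definition kappa (n : nat) (x : G) : R :=
  if n == 0%N then 1 else
  rad (nabs n) x * (-1) ^+ (\sum_(k < nabs n) (nbit n k && x (nabs n - 1 - k)%N))%N.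

Definition coefk (f : nat -> G -> R) (i : nat) : R :=
  limn (fun k => fine (Gint setT (fun x => (f k x * kappa i x)%:E))).

Definition Sk (f : nat -> G -> R) (j : nat) (x : G) : R :=
  \sum_(k < j) coefk f k * kappa k x.

Definition sigmak (f : nat -> G -> R) (n : nat) (x : G) : R :=
  n%:R^-1 * \sum_(1 <= j < n.+1) Sk f j x.

Definition weakLp_p (p : R) (g : G -> R) : \bar R :=
  ereal_sup [set ((powR l p)%:E * mu [set x | (l < `|g x|)%R])%E | l in [set l : R | 0 < l]].

End Walsh.

(* Main.v *)
(** Take F = sum_n e_n (D_{2^(n+1)} - D_{2^n}) with e_n nonzero only for a very sparse set of n.
    The kappa-coefficients of F equal e_n on the block [2^n, 2^(n+1)), and p-subadditivity bounds
    the H_p norm of F by sum_n e_n^p 2^(n(p-1)).  For m = 2^n + N in such a block the part of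
    m sigma_m F coming from the block is e_n times sum_{2^n <= i < m} (m - i) kappa_i.  The kappa_i are
    signs, so this sum is an integer congruent to N(N+1)/2 modulo 2: for N = 1 mod 4 it is odd, hence
    at least 1 in absolute value at every point.  The earlier blocks are negligible by sparsity, so a
    quarter of the m in the block satisfy |sigma_m F| >= e_n / 2^(n+2) everywhere, which contributes
    about 2^(n(2-2p)) / Phi(2^(n+1)) times e_n^p 2^(n(p-1)) to the series. *)
Require Import Defs.
From HB Require Import structures.
From mathcomp Require Import all_boot all_order all_algebra.
From mathcomp Require Import all_classical all_reals all_analysis.
From mathcomp Require Import measurable_realfun zify ring lra.
Import Order.TTheory GRing.Theory Num.Theory.
Import numFieldNormedType.Exports.
Local Open Scope classical_set_scope.
Local Open Scope ring_scope.

(** * Integrals of functions of finitely many coordinates as dyadic averages *)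

Section DyadicIntegrals.
Context {R : realType}.
Implicit Types (g h : G -> R) (n : nat).

Definition digits_of (n s : nat) : G := fun k => odd (s %/ 2 ^ (n.-1 - k)).

Definition dyadic_itv n (s : nat) : set R :=
  `[s%:R / 2 ^+ n, s.+1%:R / 2 ^+ n[%classic.

Lemma mem_dyadic_itv n s (t : R) :
  dyadic_itv n s t <-> s%:R <= t * 2 ^+ n < s.+1%:R.
Proof.
by rewrite /dyadic_itv /= in_itv /= ler_pdivrMr ?ltr_pdivlMr ?exprn_gt0.
Qed.

Lemma digits_dyadic_itv n s (t : R) k :
  dyadic_itv n s t -> (k < n)%N -> digits t k = digits_of n s k.
Proof.
move=> /mem_dyadic_itv /andP[h1 h2] kn; rewrite /digits /digits_of.
congr (odd _); apply: truncn_def.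
(* Coordinate [k] from the left is bit [j] from the right, so [t * 2 ^+ k.+1] arises from
   [t * 2 ^+ n] by dividing by [2 ^+ j]. *)
set j := (n.-1 - k)%N.
have nE : n = (k.+1 + j)%N by rewrite /j; lia.
have p2 : 0 < 2 ^+ j :> R by rewrite exprn_gt0.
have e2 : t * 2 ^+ n = t * 2 ^+ k.+1 * 2 ^+ j by rewrite nE exprD mulrA.
rewrite e2 in h1 h2.
apply/andP; split.
  rewrite -(ler_pM2r p2); apply: le_trans h1.
  by rewrite -natrX -natrM ler_nat leq_divM.
rewrite -(ltr_pM2r p2); apply: (lt_le_trans h2).
by rewrite -natrX -natrM ler_nat ltn_ceil ?expn_gt0.
Qed.

Lemma I01_dyadic n :
  (@I01 R) = \big[setU/set0]_(s <- iota 0 (2 ^ n)) dyadic_itv n s.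
Proof.
rewrite -bigcup_seq; apply/seteqP; split => t /=.
  rewrite /I01 /= => /andP[t0 t1].
  have ge0 : 0 <= t * 2 ^+ n by rewrite mulr_ge0 ?exprn_ge0.
  exists (Num.truncn (t * 2 ^+ n)).
    rewrite /= mem_iota add0n leq0n /=.
    rewrite -(ltr_nat R); have /andP[h _] := truncn_itv ge0.
    by apply: (le_lt_trans h); rewrite natrX -[ltRHS]mul1r ltr_pM2r ?exprn_gt0.
  by apply/mem_dyadic_itv; exact: truncn_itv.
move=> [s /=]; rewrite mem_iota add0n leq0n /= => sn /mem_dyadic_itv /andP[h1 h2].
have p2 : 0 < 2 ^+ n :> R by rewrite exprn_gt0.
apply/andP; split.
  by rewrite -(pmulr_lge0 _ p2); apply: le_trans h1.
rewrite -(ltr_pM2r p2) mul1r; apply: (lt_le_trans h2).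
by rewrite -natrX ler_nat.
Qed.

Lemma Fn_meas_digits n g s t :
  Fn_meas n g -> dyadic_itv n s t -> g (digits t) = g (digits_of n s).
Proof. by move=> gn ts; apply: gn => i ni; exact: digits_dyadic_itv ts ni. Qed.

Lemma measurable_dyadic_itv n s : measurable (dyadic_itv n s).
Proof. exact: measurable_itv. Qed.

Lemma measurable_I01 : measurable (@I01 R).
Proof.
rewrite (I01_dyadic 0); apply: bigsetU_measurable => *; exact: measurable_dyadic_itv.
Qed.

Lemma measurable_fun_digits n g : Fn_meas n g ->
  measurable_fun (@I01 R) (g \o @digits R).
Proof.
(* The domain is enlarged to the union over all [s], so that countable gluing of constant pieces
   applies. *)
move=> gn; apply: (@measurable_funS _ _ _ _ (\bigcup_s dyadic_itv n s)).
- by apply: bigcup_measurable => *; exact: measurable_dyadic_itv.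
- rewrite (I01_dyadic n) -bigcup_seq => t [s _ ts]; by exists s.
- apply/measurable_fun_bigcup => [s|s]; first exact: measurable_dyadic_itv.
  apply: (@eq_measurable_fun _ _ _ _ _ (cst (g (digits_of n s)))) => //.
  by move=> t; rewrite inE => ts /=; rewrite (@Fn_meas_digits n _ s).
Qed.

Lemma trivIset_dyadic_itv n (D : set nat) : trivIset D (dyadic_itv n).
Proof.
move=> s s' _ _ [t [/mem_dyadic_itv h1 /mem_dyadic_itv h2]].
by rewrite -(truncn_def h1) -(truncn_def h2).
Qed.

Definition avg n g : R := (2 ^+ n)^-1 * \sum_(0 <= s < 2 ^ n) g (digits_of n s).

Lemma lebesgue_dyadic_itv n s :
  lebesgue_measure (dyadic_itv n s) = ((2 ^+ n)^-1)%:E.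
Proof.
rewrite /dyadic_itv lebesgue_measure_itv /= lte_fin ltr_pM2r ?invr_gt0 ?exprn_gt0 //.
by rewrite ltr_nat ltnSn -EFinB -mulrBl -natrB // subSnn mul1r.
Qed.

(** The integrand is constant on each of the [2 ^ n] intervals of length [2 ^- n]. This turns the
    later integral computations into finite sums. *)
Lemma Gint_avg n g : Fn_meas n g ->
  Gint setT (fun x => (g x)%:E) = (avg n g)%:E.
Proof.
move=> gn; rewrite /Gint preimage_setT setIT (I01_dyadic n) /=.
apply: etrans.
  apply: (@integral_bigsetU_EFin _ _ R lebesgue_measure nat (dyadic_itv n)
            (fun t => g (digits t))).
  - by move=> s; exact: measurable_dyadic_itv.
  - exact: iota_uniq.
  - exact: trivIset_dyadic_itv.
  - rewrite -I01_dyadic; apply/measurable_EFinP; exact: measurable_fun_digits gn.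
rewrite /avg mulr_sumr -sumEFin /index_iota subn0.
apply: eq_bigr => s _.
rewrite (@eq_integral _ _ _ _ _ (cst (g (digits_of n s))%:E)).
  apply: etrans; first by apply: integral_cst; exact: measurable_dyadic_itv.
  transitivity ((g (digits_of n s))%:E * lebesgue_measure (dyadic_itv n s))%E => //.
  by rewrite lebesgue_dyadic_itv -EFinM mulrC.
by move=> t; rewrite inE => ts /=; rewrite (@Fn_meas_digits n _ s).
Qed.

Definition Eint g : R := fine (Gint setT (fun x => (g x)%:E)).

Lemma EintE n g : Fn_meas n g -> Eint g = avg n g.
Proof. by move=> gn; rewrite /Eint (Gint_avg n). Qed.

Lemma Gint_Eint n g : Fn_meas n g -> Gint setT (fun x => (g x)%:E) = (Eint g)%:E.
Proof. by move=> gn; rewrite (EintE n) // (Gint_avg n). Qed.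

Lemma Fn_measS n m g : (n <= m)%N -> Fn_meas n g -> Fn_meas m g.
Proof. by move=> nm gn x y xy; apply: gn => i ni; apply: xy; exact: leq_trans nm. Qed.

Lemma Fn_measD n g h : Fn_meas n g -> Fn_meas n h -> Fn_meas n (fun x => g x + h x).
Proof. by move=> gn hn x y xy; rewrite (gn x y xy) (hn x y xy). Qed.

Lemma Fn_measM n g h : Fn_meas n g -> Fn_meas n h -> Fn_meas n (fun x => g x * h x).
Proof. by move=> gn hn x y xy; rewrite (gn x y xy) (hn x y xy). Qed.

Lemma Fn_meas_sum n k (F : nat -> G -> R) :
  (forall i, (i < k)%N -> Fn_meas n (F i)) -> Fn_meas n (fun x => \sum_(0 <= i < k) F i x).
Proof.
by move=> Fm x y xy; apply: eq_big_nat => i /andP[_ ik]; exact: Fm.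
Qed.

Lemma Fn_meas_coord n k (f : bool -> R) : (k < n)%N -> Fn_meas n (fun x => f (x k)).
Proof. by move=> kn x y xy; rewrite xy. Qed.

Lemma EintD n g h : Fn_meas n g -> Fn_meas n h ->
  Eint (fun x => g x + h x) = Eint g + Eint h.
Proof.
move=> gn hn; rewrite !(EintE n) //; last exact: Fn_measD.
by rewrite /avg big_split mulrDr.
Qed.

Lemma EintZ n (c : R) g : Fn_meas n g -> Eint (fun x => c * g x) = c * Eint g.
Proof.
move=> gn; rewrite !(EintE n) //; last exact: Fn_measM.
by rewrite /avg -mulr_sumr mulrCA.
Qed.

Lemma Eint_sum n k (F : nat -> G -> R) :
  (forall i, (i < k)%N -> Fn_meas n (F i)) ->
  Eint (fun x => \sum_(0 <= i < k) F i x) = \sum_(0 <= i < k) Eint (F i).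
Proof.
move=> Fm; rewrite (EintE n); last exact: Fn_meas_sum.
rewrite /avg exchange_big mulr_sumr; apply: eq_big_nat => i /andP[_ ik].
by rewrite (EintE n) //; exact: Fm.
Qed.

Lemma Eint1 : Eint (fun=> 1) = 1.
Proof. by rewrite (EintE 0) // /avg expn0 big_nat1 expr0 invr1 mul1r. Qed.

Lemma sum_nat_double (f : nat -> R) N :
  \sum_(0 <= s < N.*2) f s = \sum_(0 <= s < N) (f s.*2 + f s.*2.+1).
Proof.
elim: N => [|N IH]; first by rewrite !big_geq.
by rewrite doubleS !big_nat_recr //= IH addrA.
Qed.

(* The two halves of each atom of F_n carry opposite signs of r_n. *)
Lemma Eint_rad n g : Fn_meas n g -> Eint (fun x => Defs.rad R n x * g x) = 0.
Proof.
move=> gn; rewrite (EintE n.+1); last first.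
  apply: Fn_measM; last exact: Fn_measS gn.
  exact: (@Fn_meas_coord n.+1 n (fun b => (-1) ^+ b)).
rewrite /avg expnS mul2n sum_nat_double big1 ?mulr0 // => s _.
(* The atom numbered [s] splits into those numbered [2s] and [2s + 1]: they share the first [n]
   coordinates, and coordinate [n] is the added bit [b]. *)
have E (b : bool) k : (k < n)%N -> digits_of n.+1 (b + s.*2) k = digits_of n s k.
  move=> kn; rewrite /digits_of /=.
  have -> : (n - k)%N = (n.-1 - k).+1 by lia.
  by rewrite expnS divnMA divn2 half_bit_double.
have En (b : bool) : digits_of n.+1 (b + s.*2) n = b.
  by rewrite /digits_of /= subnn expn0 divn1 oddD odd_double addbF oddb.
have gE (b : bool) : g (digits_of n.+1 (b + s.*2)) = g (digits_of n s).
  by apply: gn => k kn; exact: E.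
have := gE true; have := gE false; have := En true; have := En false.
rewrite /= add0n add1n /Defs.rad => -> -> -> ->.
by rewrite expr0 expr1 mul1r mulN1r subrr.
Qed.

(** Indicator of the dyadic interval I_n(0), in product form so that the last coordinate can be
    split off. *)
Definition ind0 n (x : G) : R := \prod_(i < n) (~~ x i)%:R.

Lemma Fn_meas_ind0 n : Fn_meas n (ind0 n).
Proof. by move=> x y xy; apply: eq_bigr => i _; rewrite xy. Qed.

Lemma Eint_ind0 n : Eint (ind0 n) = (2 ^+ n)^-1.
Proof.
elim: n => [|n IH].
  rewrite expr0 invr1 -Eint1; congr Eint; apply/funext => x.
  by rewrite /ind0 big_ord0.
(* The new factor is (1 + r_n) / 2, and the part containing r_n has mean zero. *)
have -> : ind0 n.+1 = (fun x => 2^-1 * (Defs.rad R n x * ind0 n x + ind0 n x)).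
  apply/funext => x; rewrite /ind0 big_ord_recr /= /Defs.rad.
  by case: (x n); rewrite /= ?expr0 ?expr1; lra.
have m1 : Fn_meas n.+1 (ind0 n) by apply: Fn_measS (Fn_meas_ind0 n).
have m2 : Fn_meas n.+1 (fun x => Defs.rad R n x * ind0 n x).
  apply: Fn_measM m1; exact: (@Fn_meas_coord n.+1 n (fun b => (-1) ^+ b)).
rewrite (EintZ n.+1) ?(EintD n.+1) //; last exact: Fn_measD.
by rewrite Eint_rad ?add0r ?IH ?exprS ?invfM //; exact: Fn_meas_ind0.
Qed.

End DyadicIntegrals.

(** * The lacunary martingale and its Walsh-Kaczmarz coefficients *)

Section Martingale.
Context {R : realType}.
Implicit Types (g h : G -> R) (n i k : nat).
Variable e : nat -> R.

(* Equals [r_n D_{2^n}], the difference [D_{2^(n+1)} - D_{2^n}] of Dirichlet kernels. *)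
Definition dirichlet_block n (x : G) : R := Defs.rad R n x * (2 ^+ n * ind0 n x).

Definition lacunary_martingale k (x : G) : R :=
  \sum_(0 <= n < k) e n * dirichlet_block n x.

Lemma Fn_meas_rad n m : (n < m)%N -> Fn_meas m (Defs.rad R n).
Proof. exact: (@Fn_meas_coord _ m n (fun b => (-1) ^+ b)). Qed.

Lemma Fn_meas_dirichlet_block n m : (n < m)%N -> Fn_meas m (dirichlet_block n).
Proof.
move=> nm; apply: Fn_measM; first exact: Fn_meas_rad.
by apply: Fn_measM => //; apply: Fn_measS (Fn_meas_ind0 n); exact: ltnW.
Qed.

Lemma Fn_meas_lacunary k m : (k <= m)%N -> Fn_meas m (lacunary_martingale k).
Proof.
move=> km x y xy; rewrite /lacunary_martingale big_nat [RHS]big_nat.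
apply: eq_bigr => n /andP[_ nk]; congr (_ * _).
by apply: (@Fn_meas_dirichlet_block n m) => //; exact: leq_trans km.
Qed.

(** The part of kappa_i besides its Rademacher factor; it depends only on coordinates below
    [nabs i], as [Eint_rad] requires. *)
Definition kappa_sign i (x : G) : R :=
  (-1) ^+ (\sum_(k < nabs i) (nbit i k && x (nabs i - 1 - k)%N))%N.

Lemma kappaE i x : (0 < i)%N -> kappa R i x = Defs.rad R (nabs i) x * kappa_sign i x.
Proof. by rewrite /kappa; case: eqP => // ->. Qed.

Lemma Fn_meas_kappa_sign i : Fn_meas (nabs i) (kappa_sign i).
Proof.
move=> x y xy; rewrite /kappa_sign; congr (_ ^+ _).
apply: eq_bigr => k _; rewrite xy //.
by have := ltn_ord k; lia.
Qed.

Lemma Fn_meas_kappa i : Fn_meas (nabs i).+1 (kappa R i).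
Proof.
case: i => [|i]; first by move=> x y _; rewrite /kappa eqxx.
move=> x y xy; rewrite !kappaE //.
apply: (@Fn_measM _ (nabs i.+1).+1) xy; first exact: Fn_meas_rad.
by apply: Fn_measS (Fn_meas_kappa_sign i.+1).
Qed.

(** On I_{|i|}(0) every coordinate read by the sign is 0; off it both sides vanish. *)
Lemma kappa_sign_ind0 i x : kappa_sign i x * ind0 (nabs i) x = ind0 (nabs i) x :> R.
Proof.
rewrite /ind0; case: (boolP [exists k : 'I_(nabs i), x k]) => [/existsP[k xk]|/existsPn xk].
  by rewrite (bigD1 k) //= xk !mul0r mulr0.
rewrite /kappa_sign big1 ?expr0 ?mul1r // => k _.
have h : (nabs i - 1 - k < nabs i)%N by have := ltn_ord k; lia.
by have := xk (Ordinal h) => /= /negbTE ->; rewrite andbF.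
Qed.

Lemma rad_sqr n x : Defs.rad R n x * Defs.rad R n x = 1.
Proof. by rewrite /Defs.rad -expr2 sqrr_sign. Qed.

(** If [nabs i] and [n] differ, the Rademacher factor of larger index multiplies a function of
    earlier coordinates and kills the integral. If they agree, the two factors cancel and
    [2 ^+ n * ind0 n], of mean 1, remains. *)
Lemma Eint_block_kappa n i :
  Eint (fun x => dirichlet_block n x * kappa R i x) = ((0 < i)%N && (nabs i == n))%:R.
Proof.
have m0 m : (n <= m)%N -> Fn_meas m (fun x : G => 2 ^+ n * ind0 n x : R).
  by move=> nm; apply: Fn_measM => //; apply: Fn_measS (Fn_meas_ind0 n).
case: (posnP i) => [->|i0] /=.
  apply: etrans (Eint_rad _ _ (m0 n (leqnn n))); congr Eint; apply/funext => x.
  by rewrite /kappa eqxx mulr1.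
case: (ltngtP (nabs i) n) => /= ni.
- have <- : (fun x => Defs.rad R n x * (2 ^+ n * ind0 n x * kappa R i x)) =
            (fun x => dirichlet_block n x * kappa R i x).
    by apply/funext => x; rewrite /dirichlet_block mulrA.
  apply: Eint_rad; apply: Fn_measM; first exact: m0.
  by apply: Fn_measS (Fn_meas_kappa i).
- have <- : (fun x => Defs.rad R (nabs i) x * (dirichlet_block n x * kappa_sign i x)) =
            (fun x => dirichlet_block n x * kappa R i x).
    by apply/funext => x; rewrite kappaE // mulrCA.
  apply: Eint_rad; apply: Fn_measM; first exact: Fn_meas_dirichlet_block.
  exact: Fn_meas_kappa_sign.
- transitivity (Eint (fun x => 2 ^+ n * ind0 n x : R)).
    congr Eint; apply/funext => x; rewrite kappaE // /dirichlet_block ni.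
    rewrite mulrACA rad_sqr mul1r -mulrA [ind0 _ _ * _]mulrC.
    by rewrite -ni kappa_sign_ind0.
  rewrite (EintZ n _ _ (Fn_meas_ind0 n)) Eint_ind0 divff //.
Qed.

Lemma coefk_lacunary i :
  coefk lacunary_martingale i = if (0 < i)%N then e (nabs i) else 0.
Proof.
(* The sequence of integrals is constant once [nabs i < k], when the only block that kappa_i can
   detect has entered the sum. *)
rewrite /coefk; apply: cvg_lim => //; apply: (@cvg_near_cst).
near=> k.
have ik : (nabs i < k)%N by near: k; exists (nabs i).+1.
change (Eint (fun x => lacunary_martingale k x * kappa R i x) =
  if (0 < i)%N then e (nabs i) else 0).
have -> : (fun x => lacunary_martingale k x * kappa R i x) =
   (fun x => \sum_(n <- index_iota 0 k) e n * (dirichlet_block n x * kappa R i x)).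
  apply/funext => x; rewrite /lacunary_martingale mulr_suml.
  by apply: eq_bigr => n _; rewrite mulrA.
have bm n m : (n < m)%N -> (nabs i < m)%N ->
    Fn_meas m (fun x => dirichlet_block n x * kappa R i x).
  move=> nm im; apply: Fn_measM; first exact: Fn_meas_dirichlet_block.
  by apply: Fn_measS (Fn_meas_kappa i).
rewrite (Eint_sum k); last by move=> n nk; apply: Fn_measM => //; exact: bm.
transitivity (\sum_(0 <= n < k) e n * ((0 < i)%N && (nabs i == n))%:R).
  apply: eq_big_nat => n /andP[_ nk].
  by rewrite (EintZ k) ?Eint_block_kappa //; exact: bm.
rewrite (bigD1_seq (nabs i)) ?iota_uniq ?mem_index_iota //= eqxx andbT.
rewrite big1 => [|n ni]; first by case: (0 < i)%N; rewrite addr0 ?mulr1 ?mulr0.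
by rewrite eq_sym (negbTE ni) andbF mulr0.
Unshelve. all: by end_near.
Qed.

(** Moves the restriction into the integrand, so that the mean-value rules on the whole group
    apply. *)
Lemma Gint_Idy n x h : Gint (Idy n x) (fun y => (h y)%:E) =
  Gint setT (fun y => (\1_(Idy n x) y * h y)%:E).
Proof.
rewrite /Gint preimage_setT setIT integral_mkcondr; apply: eq_integral => t _ /=.
rewrite /patch indicE.
have -> : (t \in @digits R @^-1` Idy n x) = (digits t \in Idy n x) by [].
by case: ifP => _; rewrite ?mul1r ?mul0r.
Qed.

Lemma martingale_lacunary : martingale lacunary_martingale.
Proof.
split=> [n|n x]; first exact: Fn_meas_lacunary.
have mi : Fn_meas n (\1_(Idy n x) : G -> R).
  move=> y z yz; rewrite !indicE; congr (_%:R); congr (nat_of_bool _).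
  by apply/idP/idP; rewrite !inE /Idy /= => H i ni; rewrite -H // ?yz // -yz.
have mi' := Fn_measS _ n.+1 _ (leqnSn n) mi.
rewrite !Gint_Idy (Gint_Eint n.+1); last first.
  by apply: Fn_measM => //; exact: Fn_meas_lacunary.
rewrite (Gint_Eint n.+1); last first.
  by apply: Fn_measM => //; exact: Fn_meas_lacunary.
congr EFin.
(* The increment is r_n times an F_n-measurable function, hence integrates to 0 over each atom of
   F_n. *)
have -> : (fun y => \1_(Idy n x) y * lacunary_martingale n.+1 y) = (fun y =>
  \1_(Idy n x) y * lacunary_martingale n y +
  Defs.rad R n y * (e n * (2 ^+ n * ind0 n y) * \1_(Idy n x) y)).
  apply/funext => y; rewrite /lacunary_martingale big_nat_recr //=.
  by rewrite /dirichlet_block; ring.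
have mb : Fn_meas n (fun y => e n * (2 ^+ n * ind0 n y) * \1_(Idy n x) y).
  by apply: Fn_measM => //; apply: Fn_measM => //; apply: Fn_measM => //; exact: Fn_meas_ind0.
rewrite (EintD n.+1).
- by rewrite Eint_rad ?addr0.
- by apply: Fn_measM => //; exact: Fn_meas_lacunary.
- by apply: Fn_measM; [exact: Fn_meas_rad|exact: Fn_measS mb].
Qed.

End Martingale.

(** * The Hardy norm of the lacunary martingale, by p-subadditivity *)

Section HardyNorm.
Context {R : realType}.
Variables (e : nat -> R) (p : R).
Hypothesis (p01 : 0 < p <= 1).
Hypothesis e0 : forall n, 0 <= e n.

Lemma le_powR_le1 (x : R) : 0 <= x <= 1 -> x <= powR x p.
Proof.
case/andP => x0 x1; move: x0; rewrite le_eqVlt => /orP[/eqP <-|x0].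
  exact: powR_ge0.
rewrite -[leLHS]powRr1; last exact: ltW.
by apply: ger_powR; [rewrite x0 | case/andP: p01].
Qed.

Lemma powR_subadd (a b : R) : 0 <= a -> 0 <= b -> powR (a + b) p <= powR a p + powR b p.
Proof.
move=> a0 b0; have := addr_ge0 a0 b0; rewrite le_eqVlt => /orP[/eqP s0|s0].
  by rewrite -s0 powR0 ?addr_ge0 ?powR_ge0 // gt_eqF; case/andP: p01.
(* The share [c / (a + b)] lies between 0 and 1, so it is at most its own p-th power; the shares of
   [a] and [b] sum to 1. *)
have E c : 0 <= c -> c <= a + b -> c / (a + b) * powR (a + b) p <= powR c p.
  move=> c0 cs.
  have -> : powR c p = powR (c / (a + b)) p * powR (a + b) p.
    by rewrite -powRM ?divr_ge0 ?divfK ?lt0r_neq0 // ltW.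
  apply: ler_wpM2r; first exact: powR_ge0.
  by apply: le_powR_le1; rewrite divr_ge0 ?(ltW s0) //= ler_pdivrMr // mul1r.
have := lerD (E a a0 _) (E b b0 _); rewrite -mulrDl -mulrDl divff ?lt0r_neq0 // mul1r.
by apply; rewrite ?lerDl ?lerDr.
Qed.

Lemma ind0_01 n x : ind0 n x = 0 :> R \/ ind0 n x = 1 :> R.
Proof.
rewrite /ind0; elim/big_rec: _ => [|i y _ [->|->]]; first by right.
- by left; rewrite mulr0.
- by case: (x i); [left|right]; rewrite mulr1.
Qed.

Lemma powR_ind0 n x : powR (ind0 n x) p = ind0 n x.
Proof.
have p0 : p != 0 by rewrite gt_eqF //; case/andP: p01.
by case: (ind0_01 n x) => ->; rewrite ?powR0 ?powR1.
Qed.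

Lemma le_poweR (r : R) (x y : \bar R) : 0 <= r -> (0 <= x)%E -> (x <= y)%E ->
  (poweR x r <= poweR y r)%E.
Proof.
move=> r0 x0 xy; have y0 := le_trans x0 xy.
by apply: gt0_ler_poweR => //; rewrite in_itv /= leey andbT.
Qed.

(** The p-th power of the constant modulus of [e n * dirichlet_block n] on I_n(0). *)
Definition block_weight n : R := powR (e n * 2 ^+ n) p.

Lemma lacunary_powR_le k x :
  powR `|lacunary_martingale e k x| p <= \sum_(0 <= n < k) block_weight n * ind0 n x.
Proof.
have p0 : p != 0 by rewrite gt_eqF //; case/andP: p01.
have pge : 0 <= p by apply: ltW; case/andP: p01.
rewrite /lacunary_martingale; elim: k => [|k IH].
  by rewrite !big_geq // normr0 powR0.
rewrite !big_nat_recr //=.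
set a := \sum_(0 <= n < k) _ in IH *; set c := e k * _.
have h : powR `|a + c| p <= powR (`|a| + `|c|) p.
  by apply: ge0_ler_powR; rewrite ?nnegrE ?addr_ge0 ?ler_normD.
apply: (le_trans h); apply: le_trans (powR_subadd _ _ (normr_ge0 _) (normr_ge0 _)) _.
apply: lerD => //; rewrite /c.
rewrite /dirichlet_block /Defs.rad !normrM normr_sign mul1r (ger0_norm (e0 k)).
rewrite [`|2 ^+ k|]ger0_norm ?exprn_ge0 // mulrA.
rewrite powRM ?mulr_ge0 ?exprn_ge0 //.
have -> : `|ind0 k x : R| = ind0 k x by case: (ind0_01 k x) => ->; rewrite ?normr0 ?normr1.
by rewrite powR_ind0.
Qed.

Lemma maxf_lacunary_le x :
  (poweR (maxf (lacunary_martingale e) x) p <=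
   \sum_(0 <= n <oo) (block_weight n * ind0 n x)%:E)%E.
Proof.
have p0 : 0 < p by case/andP: p01.
set S := (X in (_ <= X)%E).
have w0 n : (0 <= (block_weight n * ind0 n x)%:E)%E.
  by rewrite lee_fin mulr_ge0 ?powR_ge0 //; case: (ind0_01 n x) => ->.
have S0 : (0 <= S)%E by apply: nneseries_ge0.
(* With the bound written as a p-th power, monotonicity removes the outer exponent and the supremum
   can be estimated one [k] at a time. *)
have SE : S = poweR (poweR S p^-1) p by rewrite -poweRrM mulVf ?gt_eqF // poweRe1.
have m0 : (0 <= maxf (lacunary_martingale e) x)%E.
  by apply: le_trans (ereal_sup_ubound _); last by exists 0%N => //; rewrite lee_fin.
rewrite SE; apply: le_poweR => //; first exact: ltW.
apply: ge_ereal_sup => _ [k _ <-].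
have -> : (`|lacunary_martingale e k x|%:E = poweR (poweR (`|lacunary_martingale e k x|%:E) p) p^-1)%E.
  by rewrite -poweRrM divff ?gt_eqF // poweRe1.
apply: le_poweR; [by rewrite invr_ge0 ltW|exact: poweR_ge0|].
apply: le_trans (nneseries_lim_ge k _) => //.
by rewrite sumEFin lee_fin; exact: lacunary_powR_le.
Qed.

Lemma measurable_maxf :
  measurable_fun (@I01 R) (fun t => poweR (maxf (lacunary_martingale e) (digits t)) p).
Proof.
apply: (measurableT_comp (measurable_poweR p)).
rewrite (_ : (fun t => _) = (fun t => esups (fun k => `|lacunary_martingale e k (digits t)|%:E) 0)).
  apply: measurable_fun_esups => k; apply/measurable_EFinP.
  apply: measurableT_comp => //.
  by apply: (@measurable_fun_digits _ k); exact: Fn_meas_lacunary.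
apply/funext => t; rewrite /maxf /esups /sdrop; congr ereal_sup.
by apply/seteqP; split => _ [k _ <-]; exists k.
Qed.

(** The pointwise bound on the maximal function is integrated term by term; [ind0 n] has mean
    [2 ^- n], which produces the series in the hypothesis. *)
Lemma in_Hp_lacunary (B : R) :
  (forall N, \sum_(0 <= n < N) block_weight n / 2 ^+ n <= B) ->
  in_Hp p (lacunary_martingale e).
Proof.
move=> hB; split; first exact: martingale_lacunary.
have mw n : Fn_meas n (fun x => block_weight n * ind0 n x).
  by apply: Fn_measM => //; exact: Fn_meas_ind0.
have w0 n x : (0 <= (block_weight n * ind0 n x)%:E)%E.
  by rewrite lee_fin mulr_ge0 ?powR_ge0 //; case: (ind0_01 n x) => ->.
have mwd n : measurable_fun (@I01 R) (fun t => (block_weight n * ind0 n (digits t))%:E).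
  by apply/measurable_EFinP; exact: (@measurable_fun_digits _ n _ (mw n)).
apply: (@le_lt_trans _ _ (B%:E)); last exact: ltry.
rewrite /Gint preimage_setT setIT.
apply: le_trans.
  apply: (@ge0_le_integral _ _ _ lebesgue_measure (@I01 R) _ _
    (fun t => \sum_(0 <= n <oo) (block_weight n * ind0 n (digits t))%:E)%E).
  - exact: measurable_I01.
  - by move=> t _; exact: poweR_ge0.
  - exact: measurable_maxf.
  - by apply: ge0_emeasurable_sum => [n t _ _|n _]; [exact: w0|exact: mwd].
  - by move=> t _; exact: maxf_lacunary_le.
rewrite integral_nneseries //; last exact: measurable_I01.
apply: lime_le; first by apply: is_cvg_nneseries => n _ _; exact: integral_ge0.
apply: nearW => N.
rewrite (_ : (\sum_(0 <= n < N) _)%E = (\sum_(0 <= n < N) block_weight n / 2 ^+ n)%:E) ?lee_fin //.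
rewrite -sumEFin; apply: eq_bigr => n _.
have := Gint_Eint n _ (mw n).
rewrite (EintZ n _ _ (Fn_meas_ind0 n)) Eint_ind0 => <-.
by rewrite /Gint preimage_setT setIT.
Qed.

End HardyNorm.

(** * Pointwise lower bounds for the Fejér means *)

Section FejerMeans.
Context {R : realType}.

(** The term [a k] occurs in the partial sums of lengths [k + 1] to [m], that is [m - k] times. *)
Lemma sum_partial_sums (a : nat -> R) m :
  \sum_(1 <= j < m.+1) \sum_(k < j) a k = \sum_(0 <= k < m) (m - k)%:R * a k.
Proof.
elim: m => [|m IH]; first by rewrite !big_geq.
rewrite big_nat_recr //= {}IH big_nat_recr //= subSnn mul1r.
rewrite -(big_mkord xpredT) big_nat_recr //= addrA -big_split /=; congr (_ + _).
by apply: eq_big_nat => k /andP[_ km]; rewrite subSn 1?ltnW // mulrSr mulrDl mul1r.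
Qed.

Lemma sum_triangular a N : ((\sum_(a <= i < a + N) (a + N - i)).*2 = N * N.+1)%N.
Proof.
elim: N a => [|N IH] a; first by rewrite addn0 big_geq.
rewrite big_ltn; last by lia.
by rewrite doubleD addnS -addSn IH; lia.
Qed.

(** The value is N(N+1)/2 with N = 4q + 1, namely (4q + 1)(2q + 1), a product of odd numbers. *)
Lemma odd_sum_triangular a q : odd (\sum_(a <= i < a + (4 * q).+1) (a + (4 * q).+1 - i)).
Proof. by have := sum_triangular a (4 * q).+1; set T := (\sum_(_ <= _ < _) _)%N; nia. Qed.

(* Modulo 2 the signs disappear, so the sum is an odd integer. *)
Lemma sum_signs_ge1 a m (c : nat -> nat) : odd (\sum_(a <= i < m) (m - i)) ->
  1 <= `|\sum_(a <= i < m) (m - i)%:R * (-1) ^+ c i| :> R.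
Proof.
move=> oT.
have -> : \sum_(a <= i < m) (m - i)%:R * (-1) ^+ c i =
   ((\sum_(a <= i < m) (m - i))%N%:Z - 2 * (\sum_(a <= i < m) (m - i) * odd (c i))%N%:Z)%:~R :> R.
  rewrite intrB intrM /= -[X in _ - 2 * X]/(_%:R) -[X in X - _]/(_%:R) !natr_sum mulr_sumr -sumrB.
  apply: eq_bigr => i _; rewrite -signr_odd natrM; case: (odd (c i)).
    by rewrite expr1 /=; ring.
  by rewrite expr0 /=; ring.
rewrite -intr_norm ler1z; set T := (\sum_(_ <= _ < _) _)%N in oT *; set S := (\sum_(_ <= _ < _) _)%N.
lia.
Qed.

Lemma kappa_is_sign i x : exists c, kappa R i x = (-1) ^+ c.
Proof.
case: i => [|i]; first by exists 0%N; rewrite /kappa eqxx.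
by rewrite kappaE // /Defs.rad /kappa_sign -exprD; eexists.
Qed.

Lemma norm_kappa i x : `|kappa R i x| = 1.
Proof. by have [c ->] := kappa_is_sign i x; rewrite normrX normrN1 expr1n. Qed.

Variable e : nat -> R.
Hypothesis e0 : forall n, 0 <= e n.

Let f := lacunary_martingale e.

Lemma sigmakE m x :
  sigmak f m x = m%:R^-1 * \sum_(0 <= i < m) (m - i)%:R * (coefk f i * kappa R i x).
Proof. by rewrite /sigmak /Sk (sum_partial_sums (fun k => coefk f k * kappa R k x)). Qed.

Lemma nabs_block n i : (2 ^ n <= i < 2 ^ n.+1)%N -> nabs i = n.
Proof. exact: trunc_log_eq. Qed.

Lemma coefk_block n i : (2 ^ n <= i < 2 ^ n.+1)%N -> coefk f i = e n.
Proof.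
move=> h; rewrite coefk_lacunary (nabs_block _ _ h).
by case: ifP => //; move: h; have := expn_gt0 2 n; lia.
Qed.

Lemma coefk_ge0 i : 0 <= coefk f i.
Proof. by rewrite coefk_lacunary; case: ifP. Qed.

Lemma sum_coefk n : \sum_(0 <= i < 2 ^ n) coefk f i = \sum_(0 <= k < n) 2 ^+ k * e k.
Proof.
elim: n => [|n IH]; first by rewrite expn0 big_nat1 big_geq // coefk_lacunary.
rewrite big_nat_recr //= -IH (@big_cat_nat _ _ _ (2 ^ n)%N) //=; last by rewrite leq_exp2l.
congr (_ + _).
rewrite (eq_big_nat _ _ (coefk_block n)) sumr_const_nat expnS mul2n -addnn addnK.
by rewrite -natrX mulr_natl.
Qed.

(** In [m] times the mean, the indices below 2^n contribute at most [m] times the sum of their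
    coefficients, and the current block contributes [e n] times an odd integer. Dividing by
    [m < 2^(n+1)] gives the two terms. *)
Lemma sigmak_ge n q x : (2 ^ n + (4 * q).+1 < 2 ^ n.+1)%N ->
  e n / 2 ^+ n.+1 - \sum_(0 <= k < n) 2 ^+ k * e k
    <= `|sigmak f (2 ^ n + (4 * q).+1) x|.
Proof.
set m := (2 ^ n + (4 * q).+1)%N => mn.
have m0 : 0 < m%:R :> R by rewrite ltr0n /m addnS.
have nm : (2 ^ n <= m)%N by rewrite /m leq_addr.
rewrite sigmakE (@big_cat_nat _ _ _ (2 ^ n)%N 0 m) //=.
set A := \sum_(0 <= i < 2 ^ n) _; set B := \sum_(2 ^ n <= i < m) _.
have hA : `|A| <= m%:R * \sum_(0 <= k < n) 2 ^+ k * e k.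
  rewrite -sum_coefk mulr_sumr; apply: le_trans (ler_norm_sum _ _ _) _.
  apply: ler_sum => i _; rewrite !normrM norm_kappa mulr1 normr_nat.
  rewrite (ger0_norm (coefk_ge0 i)); apply: ler_wpM2r; first exact: coefk_ge0.
  by rewrite ler_nat leq_subr.
have hB : e n <= `|B|.
  have [c cE] := choice (fun i => kappa_is_sign i x).
  have -> : B = e n * \sum_(2 ^ n <= i < m) (m - i)%:R * (-1) ^+ c i.
    rewrite mulr_sumr; apply: eq_big_nat => i /andP[ni im].
    by rewrite (coefk_block n) ?cE ?ni ?(ltn_trans im) // mulrCA.
  rewrite normrM (ger0_norm (e0 n)) ler_peMr //; apply: sum_signs_ge1.
  exact: odd_sum_triangular.
rewrite normrM (gtr0_norm (x := m%:R^-1)) ?invr_gt0 // -(ler_pM2l m0) mulVKf ?gt_eqF //.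
have hm : m%:R * (e n / 2 ^+ n.+1) <= e n.
  rewrite mulrA ler_pdivrMr ?exprn_gt0 // mulrC; apply: ler_wpM2l => //.
  by rewrite -natrX ler_nat ltnW.
rewrite mulrBr; have := lerB_dist B (- A); rewrite opprK normrN addrC.
lra.
Qed.

(** The level set at height [l] is all of G, of measure 1. *)
Lemma weakLp_p_ge (p l : R) (g : G -> R) : 0 < l -> (forall x, l < `|g x|) ->
  ((powR l p)%:E <= weakLp_p p g)%E.
Proof.
move=> l0 lg; apply: ereal_sup_ubound; exists l => //=.
rewrite (_ : [set x | _] = setT); last by apply/seteqP; split => // x _ /=.
rewrite /mu preimage_setT setIT (_ : lebesgue_measure _ = 1%E) ?mule1 //.
rewrite (I01_dyadic 0) expn0 /= big_seq1.
by apply: etrans (lebesgue_dyadic_itv 0 0) _; rewrite expr0 invr1.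
Qed.

Lemma weakLp_p_ge0 (p : R) (g : G -> R) : (0 <= weakLp_p p g)%E.
Proof.
apply: le_trans (ereal_sup_ubound _); last by exists 1 => /=.
by apply: mule_ge0; [rewrite lee_fin powR_ge0|exact: (measure_ge0 lebesgue_measure)].
Qed.

End FejerMeans.

(** * Summable weights carried by a sparse sequence of indices *)

Section SparseWeights.
Context {R : realType}.
Variable ns : nat -> nat.
Hypothesis ns_lt : forall j, (ns j < ns j.+1)%N.

(** Mass [2 ^- i] sits at [ns i]. Strict growth gives [i <= ns i], so stopping the sum at [i = n]
    loses nothing. *)
Definition sparse_weight n : R := \sum_(0 <= i < n.+1) (ns i == n)%:R / 2 ^+ i.

Let ns_mono i j : (i < j)%N -> (ns i < ns j)%N.
Proof. exact: (@homo_ltn _ ns (fun a b => a < b)%N ltn_trans ns_lt). Qed.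

Let ns_inj i j : ns i = ns j -> i = j.
Proof.
by case: (ltngtP i j) => // /ns_mono; [move=> + E|move=> + E]; rewrite E ltnn.
Qed.

Let ns_ge i : (i <= ns i)%N.
Proof. by elim: i => // i IH; exact: leq_ltn_trans (ns_lt i). Qed.

Lemma sparse_weight_ns j : sparse_weight (ns j) = (2 ^+ j)^-1.
Proof.
rewrite /sparse_weight (bigD1_seq j) ?iota_uniq ?mem_index_iota //= ?ltnS ?ns_ge //.
rewrite eqxx mul1r big1 ?addr0 // => i ij.
case: eqP => [/ns_inj E|_]; last by rewrite mul0r.
by rewrite E eqxx in ij.
Qed.

Lemma sparse_weight_gap j n : (ns j < n < ns j.+1)%N -> sparse_weight n = 0.
Proof.
move=> /andP[jn nj]; rewrite /sparse_weight big1 // => i _.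
case: eqP => [E|_]; last by rewrite mul0r.
have ij : (j < i)%N.
  by rewrite ltnNge; apply/negP; rewrite leq_eqVlt => /orP[/eqP ?|/ns_mono]; subst; lia.
have : (i < j.+1)%N.
  by rewrite ltnNge; apply/negP; rewrite leq_eqVlt => /orP[/eqP ?|/ns_mono]; subst; lia.
by lia.
Qed.

Lemma sparse_weight_ge0 n : 0 <= sparse_weight n.
Proof. by apply: sumr_ge0 => i _; rewrite divr_ge0 ?exprn_ge0. Qed.

Lemma sparse_weight_le1 n : sparse_weight n <= 1.
Proof.
have [[j <-]|nj] := pselect (exists j, ns j = n).
  by rewrite sparse_weight_ns invf_le1 ?exprn_gt0 // exprn_ege1 // ler1n.
rewrite /sparse_weight big1 // => i _.
by case: eqP => [E|_]; rewrite ?mul0r //; case: nj; exists i.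
Qed.

Lemma sum_sparse_weight N : \sum_(0 <= n < N) sparse_weight n <= 2.
Proof.
apply: (@le_trans _ _ (\sum_(0 <= n < N) \sum_(0 <= i < N) (ns i == n)%:R / 2 ^+ i)).
  apply: ler_sum_nat => n /andP[_ nN].
  rewrite [leRHS](@big_cat_nat _ _ _ n.+1) //= lerDl.
  by apply: sumr_ge0 => i _; rewrite divr_ge0 ?exprn_ge0.
(* After the exchange each [i] meets at most one [n], which leaves a geometric series. *)
rewrite exchange_big /=; apply: (@le_trans _ _ (\sum_(0 <= i < N) (2 ^+ i)^-1)).
  apply: ler_sum => i _; rewrite -mulr_suml ler_piMl ?invr_ge0 ?exprn_ge0 //.
  have [iN|Ni] := ltnP (ns i) N.
    rewrite (bigD1_seq (ns i)) ?iota_uniq ?mem_index_iota //= eqxx big1 ?addr0 // => k ki.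
    by rewrite eq_sym (negbTE ki).
  by rewrite big_nat big1 // => k /andP[_ kN]; rewrite gtn_eqF // (leq_trans kN).
apply: (@le_trans _ _ (2 - 2 / 2 ^+ N)); last by rewrite gerBl divr_ge0 ?exprn_ge0.
elim: N => [|N IH]; first by rewrite big_geq // expr0 divr1 subrr.
rewrite big_nat_recr //= exprS invfM mulrA divff // mul1r.
by have := IH; lra.
Qed.

End SparseWeights.

(** * Choice of the block indices from the growth hypothesis *)

Section Selection.
Context {R : realType}.

Lemma exprn_unbounded (x A : R) : 1 < x ->
  exists n0, forall n, (n0 <= n)%N -> A <= x ^+ n.
Proof.
move=> x1; have d0 : 0 < x - 1 by rewrite subr_gt0.
(* Bernoulli's inequality. *)
have B n : 1 + n%:R * (x - 1) <= x ^+ n.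
  elim: n => [|n IH]; first by rewrite mul0r addr0 expr0.
  rewrite exprS; apply: (@le_trans _ _ (x * (1 + n%:R * (x - 1)))).
    have : 0 <= n%:R * (x - 1) * (x - 1) by rewrite !mulr_ge0 // ltW.
    by rewrite [n.+1%:R]mulrSr; lra.
  by rewrite ler_pM2l // (lt_trans _ x1).
exists (Num.truncn (`|A| / (x - 1))).+1 => n hn; apply: le_trans (B n).
have h : `|A| / (x - 1) < n%:R.
  apply: lt_le_trans (_ : (Num.truncn (`|A| / (x - 1))).+1%:R <= _); last by rewrite ler_nat.
  by have /andP[] := truncn_itv (divr_ge0 (normr_ge0 A) (ltW d0)).
rewrite ltr_pdivrMr // in h; have := ler_norm A; lra.
Qed.

Lemma limn_esup_pinfty (u : nat -> R) : limn_esup (fun k => (u k)%:E) = +oo%E ->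
  forall A N, exists2 k, (N <= k)%N & A <= u k.
Proof.
move=> hu A N; apply/not_exists2P => hn.
suff : (limn_esup (fun k => (u k)%:E) <= A%:E)%E by rewrite hu.
rewrite /limn_esup limf_esupE; apply: ge_ereal_inf.
exists (ereal_sup [set (u x)%:E | x in [set k | (N <= k)%N]]).
  by exists [set k | (N <= k)%N] => //; exists N.
apply: ge_ereal_sup => _ [k /= Nk <-]; rewrite lee_fin leNgt.
by case: (hn k) => // /negP; rewrite -ltNge => /ltW /le_gtF ->.
Qed.

Lemma powR_exprn (a p : R) n : 0 <= a -> powR (a ^+ n) p = powR a p ^+ n.
Proof. move=> a0; rewrite -[a ^+ n](powR_mulrn n a0) -[RHS](powR_mulrn n (powR_ge0 _ _)).
by rewrite -!powRrM mulrC. Qed.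

Lemma powR_invl (a p : R) : 0 <= a -> powR a^-1 p = (powR a p)^-1.
Proof.
move=> a0; rewrite -(powR_inv1 a0) -[RHS](powR_inv1 (powR_ge0 _ _)).
by rewrite -!powRrM mulrC.
Qed.

(** Each run of four consecutive terms contains one at an offset congruent to 1 modulo 4, worth at
    least [c]; the other three are nonnegative. *)
Lemma sum_nat_mod4_ge (v : nat -> \bar R) (c : R) s d :
  (forall m, (s <= m)%N -> (0 <= v m)%E) -> (forall q, (q < d)%N -> (c%:E <= v (s + (4 * q).+1)%N)%E) ->
  ((d%:R * c)%:E <= \sum_(s <= m < s + 4 * d) v m)%E.
Proof.
move=> v0; elim: d => [|d IH] hc; first by rewrite mul0r big_geq // muln0 addn0.
rewrite (@big_cat_nat _ _ _ (s + 4 * d)%N) /=; [|by lia..].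
rewrite mulrSr mulrDl mul1r EFinD; apply: leeD; first by apply: IH => q qd; apply: hc; lia.
rewrite big_ltn; last by lia.
rewrite big_ltn; last by lia.
rewrite -addnS addeCA; apply: le_trans (hc d (ltnSn d)) _.
rewrite leeDl // adde_ge0 //; first by apply: v0; lia.
by rewrite big_nat; apply: sume_ge0 => m /andP[? _]; apply: v0; lia.
Qed.

Lemma powR_two_two : powR 2 2 = 4 :> R.
Proof. by rewrite (powR_mulrn 2) // expr2 -natrM. Qed.

Variables (p : R) (Phi : nat -> R).
Hypothesis p12 : 0 < p < 1 / 2.

Definition growth_ratio k : R := powR 2 (k%:R * (2 - 2 * p)) / Phi (2 ^ k)%N.

Hypothesis ratio_unbounded : forall A N, exists2 k, (N <= k)%N & A <= growth_ratio k.

Lemma growth_ratioE k : growth_ratio k = 4 ^+ k / powR (4 ^+ k) p / Phi (2 ^ k)%N.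
Proof.
rewrite /growth_ratio; congr (_ / _).
have -> : 4 ^+ k = powR 2 (2 * k%:R) :> R.
  by rewrite powRrM powR_two_two powR_mulrn.
rewrite -powRrM -powRB; first by congr powR; ring.
by apply/implyP.
Qed.

Definition past_bound N : R := \sum_(0 <= k < N.+1) powR (2 ^+ k) p^-1.

Definition admissible j N n : Prop :=
  [/\ (N < n)%N, (1 < n)%N, 4 ^+ j <= growth_ratio n.+1 &
    8 * 2 ^+ n * past_bound N <= powR ((2 ^+ j)^-1 * 2 ^+ n) p^-1 / 2 ^+ n].

Lemma exists_admissible j N : exists n, admissible j N n.
Proof.
have /andP[p0 p2] := p12.
set y : R := powR 2 p^-1; set l : R := powR (2 ^+ j)^-1 p^-1.
have l0 : 0 < l by rewrite powR_gt0 // invr_gt0 exprn_gt0.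
(* Here [p < 1 / 2] enters: [2^(1/p) > 4], so the new coefficient outgrows any fixed multiple of the
   past. *)
have y4 : 1 < y / 4.
  rewrite ltr_pdivlMr // mul1r (_ : 4 = powR 2 2); last by rewrite (powR_mulrn 2) // -natrX.
  rewrite /y /powR !gt_eqF // ltr_expR ltr_pM2r ?ln_gt0 ?ltr1n //.
  by rewrite -[2]invrK ltf_pV2 ?posrE ?invr_gt0 //; lra.
have [n0 hn0] := exprn_unbounded (y / 4) (8 * past_bound N / l) y4.
(* With [n = k - 1], this threshold gives [n0 <= n], [N < n] and [1 < n] at once. *)
have [k hk Ak] := ratio_unbounded (4 ^+ j) (n0 + N + 3).
exists k.-1; split; [lia|lia|by rewrite prednK //; lia|].
have := hn0 k.-1; set n := k.-1 => /(_ _)/wrap[]; first by rewrite /n; lia.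
rewrite ler_pdivrMr // expr_div_n => h.
rewrite powRM ?invr_ge0 ?exprn_ge0 // powR_exprn // -/y -/l.
rewrite ler_pdivlMr ?exprn_gt0 //; move: h.
rewrite mulrAC ler_pdivlMr ?exprn_gt0 // (_ : 4 ^+ n = 2 ^+ n * 2 ^+ n); last first.
  by rewrite -exprMn; congr (_ ^+ _); rewrite -natrM.
by move=> h; lra.
Qed.

End Selection.

(** Each stage receives its own number and the index chosen just before. *)
Fixpoint greedy_seq (g : nat * nat -> nat) j : nat :=
  if j is i.+1 then g (j, greedy_seq g i) else g (0%N, 0%N).

(** * Divergence of the weighted series for the chosen coefficients *)

Section Divergence.
Context {R : realType}.
Variables (p : R) (Phi : nat -> R) (ns : nat -> nat).
Hypothesis p12 : 0 < p < 1 / 2.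
Hypothesis Phi1 : forall n : nat, (1 <= n)%N -> 1 <= Phi n.
Hypothesis Phi_mono : forall n m : nat, (1 <= n)%N -> (n <= m)%N -> Phi n <= Phi m.
Hypothesis ns_adm : forall j, admissible p Phi j.+1 (ns j) (ns j.+1).

Let ns_lt j : (ns j < ns j.+1)%N. Proof. by case: (ns_adm j). Qed.

Let b : nat -> R := sparse_weight ns.

(* Chosen so that block n contributes [(sparse_coef n * 2^n)^p / 2^n = b n] to the H_p norm. *)
Definition sparse_coef n : R := powR (b n * 2 ^+ n) p^-1 / 2 ^+ n.

Let p_gt0 : 0 < p. Proof. by case/andP: p12. Qed.

Let b_ge0 n : 0 <= b n. Proof. exact: sparse_weight_ge0. Qed.

Lemma coef_ge0 n : 0 <= sparse_coef n.
Proof. by rewrite divr_ge0 ?powR_ge0 ?exprn_ge0. Qed.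

Lemma coef_in_Hp : in_Hp p (lacunary_martingale sparse_coef).
Proof.
apply: (in_Hp_lacunary _ _ _ coef_ge0 2) => [|N].
  by rewrite p_gt0 /=; case/andP: p12 => _ h; lra.
rewrite (eq_bigr b) => [|n _]; first exact: sum_sparse_weight.
rewrite /block_weight /sparse_coef divfK ?expf_neq0 // -powRrM mulVf ?gt_eqF //.
by rewrite powRr1 ?mulr_ge0 ?exprn_ge0 // mulfK ?expf_neq0.
Qed.

Lemma sum_coef_le j :
  \sum_(0 <= k < ns j.+1) 2 ^+ k * sparse_coef k <= past_bound p (ns j).
Proof.
rewrite (@big_cat_nat _ _ _ (ns j).+1) //=.
(* Strictly between two chosen indices the weights vanish; up to [ns j] they are at most 1. *)
rewrite [X in _ + X]big_nat [X in _ + X]big1 ?addr0 => [|k /andP[jk kj]]; last first.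
  rewrite /sparse_coef /b (sparse_weight_gap _ ns_lt j) ?jk // mul0r powR0 ?mul0r ?mulr0 //.
  by rewrite invr_eq0 gt_eqF.
apply: ler_sum => k _; rewrite /sparse_coef mulrC divfK ?expf_neq0 //.
apply: ge0_ler_powR; rewrite ?nnegrE ?mulr_ge0 ?exprn_ge0 //.
  by rewrite invr_ge0 ltW.
by rewrite ler_piMl ?exprn_ge0 //; exact: sparse_weight_le1.
Qed.

Let term m : \bar R :=
  (weakLp_p p (sigmak (lacunary_martingale sparse_coef) m) * ((Phi m)^-1)%:E)%E.

Let term_ge0 m : (1 <= m)%N -> (0 <= term m)%E.
Proof.
move=> m1; apply: mule_ge0; first exact: weakLp_p_ge0.
by rewrite lee_fin invr_ge0 (le_trans ler01) // Phi1.
Qed.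

(** One index in four, [2 ^ n.-2] in all, contributes at least [powR l p / Phi (2 ^ n.+1)]. The
    total is [growth_ratio n.+1] times [2 ^- j.+1 / 16], and the ratio is at least [4 ^+ j.+1]. *)
Lemma block_sum_ge j : ((2 ^+ j.+1 / 16)%:E <=
  \sum_(2 ^ ns j.+1 <= m < 2 ^ (ns j.+1).+1) term m)%E.
Proof.
have [_ n1 hr hM] := ns_adm j; set n := ns j.+1 in n1 hr hM *.
have two0 k : 0 < 2 ^+ k :> R by rewrite exprn_gt0.
have bn : b n = (2 ^+ j.+1)^-1 by exact: sparse_weight_ns.
have eE : sparse_coef n = powR ((2 ^+ j.+1)^-1 * 2 ^+ n) p^-1 / 2 ^+ n by rewrite /sparse_coef bn.
have e_gt0 : 0 < sparse_coef n by rewrite eE divr_gt0 ?powR_gt0 ?mulr_gt0 ?invr_gt0.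
(* Half of the main term in [sigmak_ge]. The earlier blocks cost at most [l / 2], so the mean stays
   above [2 * l - l / 2 > l]. *)
pose l := sparse_coef n / 2 ^+ n.+2.
have l_gt0 : 0 < l by rewrite divr_gt0.
have lp : powR l p = (2 ^+ j.+1)^-1 * 2 ^+ n / powR (4 ^+ n.+1) p.
  have -> : l = powR ((2 ^+ j.+1)^-1 * 2 ^+ n) p^-1 / 4 ^+ n.+1.
    rewrite /l eE -mulrA -invfM; congr (_ / _).
    rewrite -exprD (_ : 4 = 2 ^+ 2); last by rewrite expr2 -natrM.
    by rewrite -exprM; congr (_ ^+ _); lia.
  rewrite powRM ?powR_ge0 ?invr_ge0 ?exprn_ge0 //.
  rewrite -powRrM mulVf ?gt_eqF // powRr1 ?mulr_ge0 ?invr_ge0 ?exprn_ge0 //.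
  by rewrite powR_invl ?exprn_ge0.
have hterm q : (2 ^ n + (4 * q).+1 < 2 ^ n.+1)%N ->
    ((powR l p / Phi (2 ^ n.+1)%N)%:E <= term (2 ^ n + (4 * q).+1)%N)%E.
  move=> hq; set m := (2 ^ n + _)%N in hq *.
  have m1 : (1 <= m)%N by rewrite /m addnS.
  have P1 := Phi1 m m1; have P2 := Phi_mono m _ m1 (ltnW hq).
  rewrite EFinM /term; apply: lee_pmul.
  - by rewrite lee_fin powR_ge0.
  - by rewrite lee_fin invr_ge0; lra.
  - apply: weakLp_p_ge => // x; apply: lt_le_trans (sigmak_ge _ coef_ge0 n q x hq).
    have h1 := sum_coef_le j; rewrite -/n in h1.
    have h2 : sparse_coef n / 2 ^+ n.+1 = 2 * l by rewrite /l [2 ^+ n.+2]exprS invfM; field; rewrite gt_eqF.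
    have h3 : past_bound p (ns j) <= l / 2.
      have -> : l / 2 = sparse_coef n / (8 * 2 ^+ n) by rewrite /l !exprS; field; rewrite gt_eqF.
      by rewrite ler_pdivlMr ?mulr_gt0 // mulrC eE.
    rewrite h2; lra.
  - by rewrite lee_fin lef_pV2 ?posrE //; lra.
(* Since [1 < n], the block length is a multiple of 4 and splits into complete runs. *)
have nE : (2 ^ n.+1 = 2 ^ n + 4 * 2 ^ n.-2)%N.
  by rewrite -{1 2}(subnK n1) subn2 !addn2 !expnS; lia.
rewrite [X in index_iota _ X]nE.
apply: (le_trans _ (sum_nat_mod4_ge term (powR l p / Phi (2 ^ n.+1)%N) _ _ _ _)).
- have -> : (2 ^ n.-2)%N%:R * (powR l p / Phi (2 ^ n.+1)%N) =
            growth_ratio p Phi n.+1 * ((2 ^+ j.+1)^-1 / 16).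
    rewrite growth_ratioE lp natrX.
    have -> : 4 ^+ n.+1 = 16 * 2 ^+ n.-2 * 2 ^+ n :> R.
      rewrite (_ : 4 = 2 * 2); last by rewrite -natrM.
      rewrite exprMn (_ : 16 = 2 ^+ 4); last by rewrite -natrX.
      rewrite -!exprD; congr (_ ^+ _); lia.
    set P := powR _ p; set Q := Phi _; set J := 2 ^+ j.+1.
    by rewrite !mulrA; lra.
  rewrite lee_fin (_ : 2 ^+ j.+1 / 16 = 4 ^+ j.+1 * ((2 ^+ j.+1)^-1 / 16)); last first.
    rewrite (_ : 4 = 2 * 2); last by rewrite -natrM.
    by rewrite exprMn !mulrA mulfK ?gt_eqF.
  by apply: ler_wpM2r => //; rewrite divr_ge0 // invr_ge0 ltW.
- by move=> m hm; apply: term_ge0; apply: leq_trans hm; rewrite expn_gt0.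
- by move=> q hq; apply: hterm; rewrite nE; lia.
Qed.

(** All terms are nonnegative, so for any level [A] a single block with [j] large already exceeds
    it. *)
Lemma weak_series_pinfty : (\sum_(1 <= m <oo) term m)%E = +oo%E.
Proof.
apply/eqyP => A A0.
have [j0 hj] := exprn_unbounded 2 (16 * A) (ltr1n R 2).
have {hj} hj : A <= 2 ^+ j0.+1 / 16.
  by rewrite ler_pdivlMr // mulrC; apply: hj.
apply: (@le_trans _ _ (2 ^+ j0.+1 / 16)%:E); first by rewrite lee_fin.
apply: le_trans (block_sum_ge j0) _.
apply: le_trans (nneseries_lim_ge (2 ^ (ns j0.+1).+1) _); last first.
  by move=> m m1 _; exact: term_ge0.
rewrite [leRHS](@big_cat_nat _ _ _ (2 ^ ns j0.+1)%N) /= ?leq_exp2l ?expn_gt0 //.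
rewrite leeDr // big_nat; apply: sume_ge0 => m /andP[m1 _]; exact: term_ge0.
Qed.

End Divergence.

Theorem theorem2 (R : realType) (p : R) (Phi : nat -> R) :
  0 < p < 1 / 2 ->
  (forall n : nat, (1 <= n)%N -> 1 <= Phi n) ->
  (forall n m : nat, (1 <= n)%N -> (n <= m)%N -> Phi n <= Phi m) ->
  Phi n @[n --> \oo] --> +oo ->
  limn_esup (fun k : nat => ((powR 2 (k%:R * (2 - 2 * p))) / Phi (2 ^ k)%N)%:E) = +oo%E ->
  exists F : nat -> G -> R,
    in_Hp p F /\
    (\sum_(1 <= m <oo) (weakLp_p p (sigmak F m) * ((Phi m)^-1)%:E))%E = +oo%E.
Proof.
move=> p12 Phi1 Phi_mono _ /limn_esup_pinfty ratio_unbounded.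
(* A choice function on pairs (stage, previous index), ready to be iterated by [greedy_seq]. *)
have [g gP] := choice (fun jN => exists_admissible p Phi p12 ratio_unbounded jN.1 jN.2).
have ns_adm j : admissible p Phi j.+1 (greedy_seq g j) (greedy_seq g j.+1).
  exact: (gP (j.+1, greedy_seq g j)).
exists (lacunary_martingale (sparse_coef p (greedy_seq g))); split.
  exact: coef_in_Hp.
exact: weak_series_pinfty _ _ _ p12 Phi1 Phi_mono ns_adm.
Qed.
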